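(* Let $n \in \mathbb{Z}_{\ge 0}$, and let $a$, $c$, $p_1,\dots,p_{n-1}$ and $q_1,\dots,q_{n-1}$ be indeterminates. Then $$\sum_{i=0}^{n} \left\{ \prod_{k=0}^{i-1} \left( \frac{1}{\mathbf{p}^{\overline{k}}} - a \right) \right\} \sum_{i \ge \nu_{i} \ge \nu_{i+1} \ge \cdots \ge \nu_{n-1} \ge 0} \ \prod_{k=i}^{n-1} \left( c\, \mathbf{q}^{\overline{k-\nu_k}} - \frac{1}{\mathbf{p}^{\overline{\nu_k}}} \right) = \prod_{k=0}^{n-1} \left(c\, \mathbf{q}^{\overline{k}} - a\right),$$ where the inner sum is over all $n-i$ non-increasing nonnegative integers $\nu_i,\dots,\nu_{n-1}$ that are at most $i$.
   Context: For $0\le m\le n-1$, $\mathbf{p}^{\overline{m}}=\prod_{k=1}^{m}p_k$ and $\mathbf{q}^{\overline{m}}=\prod_{k=1}^{m}q_k$, with $\mathbf{p}^{\overline{0}}=\mathbf{q}^{\overline{0}}=1$. Empty products equal $1$; for $i=n$ the inner sum consists of the single empty sequence and equals $1$. The identity is in the field of rational functions in the indeterminates. *)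

(* Defs.v *)
From HB Require Import structures.
From mathcomp Require Import all_boot all_order all_algebra.
From mathcomp Require Import mpoly.

Set Implicit Arguments.
Unset Strict Implicit.
Unset Printing Implicit Defensive.

Import GRing.Theory.
Local Open Scope ring_scope.

Section Indeterminates.
Variables (F : fieldType) (n : nat).

(* F(a, c, p_1, .., p_(n-1), q_1, .., q_(n-1)).  There are no p's and no q's
   when n <= 1, in accordance with 0.-1 = 1.-1 = 0. *)
Definition nvars : nat := 2 + (n.-1 + n.-1).

Definition ratfun := {fraction {mpoly F[nvars]}}.

Definition indet (v : 'I_nvars) : ratfun := tofrac ('X_v : {mpoly F[nvars]}).

Definition var_a : ratfun := indet (lshift (n.-1 + n.-1) (ord0 : 'I_2)).
Definition var_c : ratfun := indet (lshift (n.-1 + n.-1) (ord_max : 'I_2)).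

(* Ordinals start at 0: var_p k and var_q k stand for p_(k+1) and q_(k+1). *)
Definition var_p (k : 'I_n.-1) : ratfun := indet (rshift 2 (lshift n.-1 k)).
Definition var_q (k : 'I_n.-1) : ratfun := indet (rshift 2 (rshift n.-1 k)).

End Indeterminates.

(* x_1 * .. * x_m for m <= N, the ordinal k standing for the index k + 1. *)
Definition init_prod (K : fieldType) (N : nat) (x : 'I_N -> K) (m : nat) : K :=
  \prod_(k < N | (k < m)%N) x k.

(* Sequences bounded by i, of length l. In the sum indexed by
   nu_i >= .. >= nu_(n-1), one has l = n - i and nu j stands for nu_(i+j). *)
Definition nonincreasing_seq (i l : nat) (nu : {ffun 'I_l -> 'I_i.+1}) : bool :=
  [forall j : 'I_l, forall k : 'I_l, (j <= k)%N ==> (nu k <= nu j)%N].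

(* Main.v *)
Require Import Defs.
From HB Require Import structures.
From mathcomp Require Import all_boot all_order all_algebra.
From mathcomp Require Import mpoly.
From mathcomp Require Import ring.

(** The identity holds for any two sequences [P] and [Q] in a commutative
    ring, put in place of the [1 / pbar k] and the [c * qbar k]. It is the
    Newton expansion of the polynomial [\prod_(k < n) (Q k - a)] in the
    variable [a], with nodes [P 0, P 1, ...]; the inner sums are, up to sign,
    its divided differences at the nodes [P 0, ..., P i].

    The proof is an induction on [n] with [P] varying. Let [S i n P] be the
    inner sum. If the smallest entry [nu_(n-1)] is [0], its factor is
    [Q (n-1) - P 0], and the other entries form an arbitrary sequence of
    [S i (n-1) P]. Otherwise all the entries are positive; lowering each of
    them by one amounts to lowering [i] and every [k] by one and to shifting
    [P]. With [P'] the shift of [P], this gives ([weighted_sum_rec])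
      [S i n P = (Q (n-1) - P 0) * S i (n-1) P + S (i-1) (n-1) P'],
    which is the Leibniz rule for the divided difference of a product by the
    linear factor [Q (n-1) - x]. Since
      [\prod_(k < i) (P k - a) = (P 0 - a) * \prod_(k < i-1) (P' k - a)],
    summing over [i] and applying the induction hypothesis to [P] and to [P']
    multiplies [\prod_(k < n-1) (Q k - a)] by
      [(Q (n-1) - P 0) + (P 0 - a) = Q (n-1) - a]. *)

Set Implicit Arguments.
Unset Strict Implicit.
Unset Printing Implicit Defensive.

Import GRing.Theory.
Local Open Scope ring_scope.

Lemma nonincreasing_seqP (i l : nat) (nu : {ffun 'I_l -> 'I_i.+1}) :
  reflect (forall j k : 'I_l, (j <= k)%N -> (nu k <= nu j)%N)
          (nonincreasing_seq nu).
Proof.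
apply: (iffP forallP) => [H j k le_jk | H j].
  by move/forallP/(_ k)/implyP: (H j); apply.
by apply/forallP => k; apply/implyP; apply: H.
Qed.

Section WeightedSum.
Variables (R : comNzRingType) (Q : nat -> R).
Implicit Types (P : nat -> R) (i l n : nat).

Definition seq_weight P i l (nu : {ffun 'I_l -> 'I_i.+1}) : R :=
  \prod_(j < l) (Q (i + j - nu j)%N - P (nu j)).

Definition weighted_sum P i l : R :=
  \sum_(nu : {ffun 'I_l -> 'I_i.+1} | nonincreasing_seq nu) seq_weight P nu.

Definition snoc0 i l (mu : {ffun 'I_l -> 'I_i.+1}) : {ffun 'I_l.+1 -> 'I_i.+1} :=
  [ffun j => oapp mu ord0 (unlift ord_max j)].

Definition belast_seq i l (nu : {ffun 'I_l.+1 -> 'I_i.+1}) :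
    {ffun 'I_l -> 'I_i.+1} :=
  [ffun j => nu (lift ord_max j)].

Definition raise_seq i l (mu : {ffun 'I_l -> 'I_i.+1}) : {ffun 'I_l -> 'I_i.+2} :=
  [ffun j => lift ord0 (mu j)].

(** The default value [ord0] is taken only at the entries equal to [0], which
    are not in the range of [raise_seq]. *)
Definition lower_seq i l (nu : {ffun 'I_l -> 'I_i.+2}) : {ffun 'I_l -> 'I_i.+1} :=
  [ffun j => odflt ord0 (unlift ord0 (nu j))].

Lemma snoc0_max i l (mu : {ffun 'I_l -> 'I_i.+1}) : snoc0 mu ord_max = ord0.
Proof. by rewrite ffunE unlift_none. Qed.

Lemma snoc0_lift i l (mu : {ffun 'I_l -> 'I_i.+1}) (j : 'I_l) :
  snoc0 mu (lift ord_max j) = mu j.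
Proof. by rewrite ffunE liftK. Qed.

Lemma snoc0K i l : cancel (@snoc0 i l) (@belast_seq i l).
Proof. by move=> mu; apply/ffunP => j; rewrite ffunE snoc0_lift. Qed.

Lemma raise_seqK i l : cancel (@raise_seq i l) (@lower_seq i l).
Proof. by move=> mu; apply/ffunP => j; rewrite !ffunE liftK. Qed.

Lemma nonincreasing_snoc0 i l (mu : {ffun 'I_l -> 'I_i.+1}) :
  nonincreasing_seq (snoc0 mu) = nonincreasing_seq mu.
Proof.
apply/nonincreasing_seqP/nonincreasing_seqP => H j k.
  by move=> le_jk; rewrite -!(snoc0_lift mu); apply: H; rewrite !lift_max.
case: (unliftP ord_max k) => [k' ->|->]; last by rewrite snoc0_max.
case: (unliftP ord_max j) => [j' ->|->].
  by rewrite !snoc0_lift !lift_max; apply: H.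
by rewrite lift_max /= leqNgt ltn_ord.
Qed.

Lemma nonincreasing_raise i l (mu : {ffun 'I_l -> 'I_i.+1}) :
  nonincreasing_seq (raise_seq mu) = nonincreasing_seq mu.
Proof.
apply/nonincreasing_seqP/nonincreasing_seqP => H j k /H;
  by rewrite !ffunE !lift0 ltnS.
Qed.

Lemma seq_weight_snoc0 P i l (mu : {ffun 'I_l -> 'I_i.+1}) :
  seq_weight P (snoc0 mu) = (Q (i + l)%N - P 0%N) * seq_weight P mu.
Proof.
rewrite /seq_weight big_ord_recr /= snoc0_max subn0 mulrC.
congr (_ * _); apply: eq_bigr => j _.
have -> : widen_ord (leqnSn l) j = lift ord_max j.
  exact/val_inj/esym/lift_max.
by rewrite snoc0_lift.
Qed.

Lemma seq_weight_raise P i l (mu : {ffun 'I_l -> 'I_i.+1}) :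
  seq_weight P (raise_seq mu) = seq_weight (P \o succn) mu.
Proof. by apply: eq_bigr => j _; rewrite ffunE lift0 addSn subSS. Qed.

Lemma weighted_sum_last0 P i l :
  \sum_(nu : {ffun 'I_l.+1 -> 'I_i.+1} |
          nonincreasing_seq nu && (nu ord_max == ord0)) seq_weight P nu
  = (Q (i + l)%N - P 0%N) * weighted_sum P i l.
Proof.
rewrite (reindex_onto (@snoc0 i l) (@belast_seq i l)); last first.
  move=> nu /andP[_ /eqP nu0]; apply/ffunP => j.
  case: (unliftP ord_max j) => [j' ->|->]; first by rewrite snoc0_lift ffunE.
  by rewrite snoc0_max.
rewrite /weighted_sum mulr_sumr; apply: eq_big => [mu | mu _].
  by rewrite nonincreasing_snoc0 snoc0_max snoc0K !eqxx !andbT.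
exact: seq_weight_snoc0.
Qed.

Lemma weighted_sum_last_pos P i l :
  \sum_(nu : {ffun 'I_l.+1 -> 'I_i.+2} |
          nonincreasing_seq nu && (nu ord_max != ord0)) seq_weight P nu
  = weighted_sum (P \o succn) i l.+1.
Proof.
rewrite (reindex_onto (@raise_seq i l.+1) (@lower_seq i l.+1)); last first.
  move=> nu /andP[/nonincreasing_seqP nuP nu_pos]; apply/ffunP => j.
  rewrite !ffunE; case: (unliftP ord0 (nu j)) => [x -> //| nu_j0].
  (* a zero anywhere forces the last, smallest entry to vanish *)
  have := nuP j ord_max (leq_ord j); rewrite nu_j0 leqn0 => /eqP nu_max0.
  by case/eqP: nu_pos; apply: val_inj.
rewrite /weighted_sum; apply: eq_big => [mu | mu _].
  by rewrite nonincreasing_raise raise_seqK eqxx andbT ffunE andbT.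
exact: seq_weight_raise.
Qed.

Lemma weighted_sum_nil P i : weighted_sum P i 0 = 1.
Proof.
rewrite /weighted_sum (big_pred1 [ffun=> ord0]).
  by rewrite /seq_weight big_ord0.
move=> nu; transitivity true.
  by apply/nonincreasing_seqP => -[].
by symmetry; apply/eqP/ffunP => -[].
Qed.

Lemma weighted_sum_bound0 P l :
  weighted_sum P 0 l.+1 = (Q l - P 0%N) * weighted_sum P 0 l.
Proof.
rewrite -[l in Q l]add0n -weighted_sum_last0; apply: eq_bigl => nu.
by rewrite (ord1 (nu ord_max)) eqxx andbT.
Qed.

(** The Leibniz rule for divided differences, read off the smallest entry. *)
Lemma weighted_sum_rec P i l :
  weighted_sum P i.+1 l.+1 =
    (Q (i.+1 + l)%N - P 0%N) * weighted_sum P i.+1 l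
    + weighted_sum (P \o succn) i l.+1.
Proof.
rewrite -weighted_sum_last0 -weighted_sum_last_pos.
by rewrite /weighted_sum (bigID (fun nu : {ffun _} => nu ord_max == ord0)).
Qed.

Lemma newton_expansion P a n :
  \sum_(i < n.+1) (\prod_(k < i) (P k - a)) * weighted_sum P i (n - i)
  = \prod_(k < n) (Q k - a).
Proof.
elim: n P => [|n IHn] P.
  by rewrite big_ord1 weighted_sum_nil !big_ord0 mulr1.
pose basis (T : nat -> R) (i : nat) : R := \prod_(k < i) (T k - a).
have basisS i : basis P i.+1 = (P 0%N - a) * basis (P \o succn) i.
  by rewrite /basis big_ord_recl.
have step (i : 'I_n) :
    basis P i.+1 * weighted_sum P i.+1 (n - i) =
    (Q n - P 0%N) * (basis P i.+1 * weighted_sum P i.+1 (n - i.+1))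
    + (P 0%N - a) * (basis (P \o succn) i
                     * weighted_sum (P \o succn) i (n - i)).
  have lt_in := ltn_ord i.
  by rewrite -(subnSK lt_in) weighted_sum_rec subnKC // basisS; ring.
transitivity ((Q n - P 0%N) * \prod_(k < n) (Q k - a)
              + (P 0%N - a) * \prod_(k < n) (Q k - a)); last first.
  by rewrite big_ord_recr /=; ring.
rewrite -{1}(IHn P) -(IHn (P \o succn)).
(* the recurrence has a single term at both ends: no shifted sum at i = 0,
   and at i = n.+1 only the last summand of the expansion at the shifted
   nodes *)
rewrite [in LHS]big_ord_recl [in LHS]big_ord_recr.
rewrite [X in _ = _ * X + _]big_ord_recl [X in _ = _ + _ * X]big_ord_recr /=.
rewrite !subn0 !subnn weighted_sum_bound0 !weighted_sum_nil.
rewrite (eq_bigr _ (fun (i : 'I_n) _ => step i)) big_split -!mulr_sumr /=.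
rewrite -[\prod_(k < bump 0 n) _]/(basis P n.+1) basisS !big_ord0.
rewrite /basis; ring.
Qed.

End WeightedSum.

Theorem lemma11 (F : fieldType) (n : nat) :
  let a := var_a F n in
  let c := var_c F n in
  let pbar := init_prod (@var_p F n) in
  let qbar := init_prod (@var_q F n) in
  \sum_(i < n.+1)
     (\prod_(k < i) (1 / pbar k - a)) *
     (\sum_(nu : {ffun 'I_(n - i) -> 'I_i.+1} | nonincreasing_seq nu)
        \prod_(j < n - i)
           (c * qbar (i + j - nu j)%N - 1 / pbar (nu j)))
  = \prod_(k < n) (c * qbar k - a).
Proof.
move=> a c pbar qbar.
exact: (newton_expansion (fun k => c * qbar k) (fun k => 1 / pbar k) a n).
Qed.
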